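(* Let $b$ be a prime, $m,s,\alpha,d\in\mathbb{N}$, let $\boldsymbol{\gamma}=(\gamma_u)_{u\subseteq\{1,\ldots,s\}}$ be nonnegative real weights, let $p\in\mathbb{F}_b[x]$ with $\deg(p)=m$ and $\boldsymbol{q}=(q_1,\ldots,q_{ds})\in(\mathbb{F}_b[x])^{ds}$, and let $\boldsymbol{z}_n=(z_{n,1},\ldots,z_{n,ds})$, $0\le n<b^m$, be the polynomial lattice point set with generating vector $\boldsymbol{q}$ and modulus $p$. For $z\in[0,1)$ let $$\phi_{\alpha,d}(z):=\frac{(b-1)\left(b-1-b^{2\min(\alpha,d)\lfloor\log_bz\rfloor}(b^{2\min(\alpha,d)+1}-1)\right)}{b^\alpha(b^{2\min(\alpha,d)}-1)},$$ where we set $b^{2\min(\alpha,d)\lfloor\log_b0\rfloor}=0$. Let $$B_{\alpha,d,\boldsymbol{\gamma}}(\boldsymbol{q},p):=\sum_{\emptyset\ne u\subseteq\{1,\ldots,ds\}}\gamma_{v(u)}D_{\alpha,d}^{|v(u)|}\sum_{\substack{\boldsymbol{k}_u\in\mathbb{N}^{|u|}\\(\boldsymbol{k}_u,\boldsymbol{0})\in D^\perp}}r_{\alpha,d}(\boldsymbol{k}_u,\boldsymbol{0}).$$ Then $$B_{\alpha,d,\boldsymbol{\gamma}}(\boldsymbol{q},p)=\frac1{b^m}\sum_{n=0}^{b^m-1}\sum_{\emptyset\ne v\subseteq\{1,\ldots,s\}}\gamma_vD_{\alpha,d}^{|v|}\prod_{j\in v}\Big[-1+\prod_{k=1}^d\left(1+\phi_{\alpha,d}(z_{n,(j-1)d+k})\right)\Big].$$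 In particular, for product weights $\gamma_v=\prod_{j\in v}\gamma_j$, $$B_{\alpha,d,\boldsymbol{\gamma}}(\boldsymbol{q},p)=-1+\frac1{b^m}\sum_{n=0}^{b^m-1}\prod_{j=1}^s\Big[1-\gamma_jD_{\alpha,d}+\gamma_jD_{\alpha,d}\prod_{k=1}^d\left(1+\phi_{\alpha,d}(z_{n,(j-1)d+k})\right)\Big].$$
   Context: $\mathbb{N}=\{1,2,\ldots\}$, $\mathbb{N}_0=\mathbb{N}\cup\{0\}$; $\mathbb{F}_b$ is identified with $\{0,\ldots,b-1\}$. An integer $k=\kappa_0+\kappa_1b+\cdots+\kappa_{a-1}b^{a-1}\in\mathbb{N}_0$ (base-$b$ digits) is identified with the polynomial $k(x)=\kappa_0+\cdots+\kappa_{a-1}x^{a-1}\in\mathbb{F}_b[x]$. Polynomial lattice point set: $v_m\left(\sum_{l=w}^\infty t_lx^{-l}\right)=\sum_{l=\max(1,w)}^mt_lb^{-l}$ for Laurent series in $\mathbb{F}_b((x^{-1}))$, and $z_{n,i}=v_m(n(x)q_i(x)/p(x))\in[0,1)$ for $0\le n<b^m$, $1\le i\le ds$. Dual polynomial lattice: for $k=\kappa_0+\kappa_1b+\cdots$, $\mathrm{tr}_m(k)=\kappa_0+\kappa_1x+\cdots+\kappa_{m-1}x^{m-1}$ (missing digits are $0$), and $D^\perp=\{\boldsymbol{k}\in\mathbb{N}_0^{ds}:\sum_{j=1}^{ds}\mathrm{tr}_m(k_j)q_j\equiv0\pmod p\}$. $r_{\alpha,d}(0)=1$; for $k\in\mathbb{N}$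 with $b^{a-1}\le k<b^a$ put $\mu(k)=a$ and $r_{\alpha,d}(k)=(b-1)b^{-(2\min(\alpha,d)+1)\mu(k)-\alpha+1}$; $r_{\alpha,d}(\boldsymbol{k})=\prod_{j=1}^{ds}r_{\alpha,d}(k_j)$. The vector $(\boldsymbol{k}_u,\boldsymbol{0})\in\mathbb{N}_0^{ds}$ has components $k_j$ for $j\in u$ and $0$ for $j\notin u$. $v(u)\subseteq\{1,\ldots,s\}$ is the set of all $i\in\{1,\ldots,s\}$ with $u\cap\{(i-1)d+1,\ldots,id\}\ne\emptyset$, and $D_{\alpha,d}=4^{\max(d-\alpha,0)}b^{(2d-1)\alpha}$. *)

(* Defs.v *)
From HB Require Import structures.
From mathcomp Require Import all_boot all_order all_algebra.
From mathcomp Require Import all_classical all_reals all_analysis.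
From mathcomp Require Import zify.

Set Implicit Arguments.
Unset Strict Implicit.
Unset Printing Implicit Defensive.

Import Order.TTheory GRing.Theory Num.Theory.

Local Open Scope classical_set_scope.
Local Open Scope ring_scope.

Section Laurent.
Variable F : fieldType.
Implicit Types (t u : int -> F) (f p : {poly F}).

(* The carrier of F((x^-1)): [t l] is the coefficient of x^(-l), so that a
   series sum_(l >= w) t_l x^(-l) vanishes below some index w. *)
Definition laurent : set (int -> F) :=
  [set t | exists w : int, forall l : int, l < w -> t l = 0].

Definition laurent_poly f : int -> F :=
  fun l => if l <= 0 then f`_(`|l|%N) else 0.

(* For Laurent series the sum has finite support, as \sum_(_ \in _) requires
   (it would be 0 otherwise). *)
Definition laurent_mul t u : int -> F :=
  fun l => \sum_(i \in [set: int]) t i * u (l - i).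

(* t / u is the Laurent series whose product with u is t; for fractions of
   polynomials it exists and is unique, see the two lemmas below. *)
Definition laurent_div t u : int -> F :=
  xget (fun=> 0) [set w | laurent w /\ laurent_mul u w = t].

Lemma laurent_mul_polyE p t l :
  laurent_mul (laurent_poly p) t l = \sum_(j < size p) p`_j * t (l + j%:Z).
Proof.
rewrite /laurent_mul.
pose s := [seq - (j%:Z) | j <- iota 0 (size p)].
have us : uniq s by rewrite map_inj_uniq ?iota_uniq// => i j /oppr_inj [].
rewrite -(fsbig_widen [set` s] setT) //=; last first.
  move=> i [_ /= /negP si]; rewrite /laurent_poly.
  case: ifPn => [i0|_]; last by rewrite mul0r.
  rewrite nth_default ?mul0r// leqNgt; apply/negP => si'.
  case: (negP si); apply/mapP; exists `|i|%N; last by lia.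
  by rewrite mem_iota.
rewrite -fsbig_seq// big_map -[X in iota _ X]subn0 -/(index_iota 0 _) big_mkord.
apply: eq_bigr => j _; rewrite /laurent_poly.
have -> : - (j%:Z) <= 0 by lia.
by rewrite abszN absz_nat opprK.
Qed.

Lemma laurent_div_unique p t u : p != 0 -> laurent t -> laurent u ->
  laurent_mul (laurent_poly p) t = laurent_mul (laurent_poly p) u -> t = u.
Proof.
move=> p0 [w tw] [w' uw] E.
pose m : int := Num.min w w'.
have lt_m (l : int) : l < m -> t l = u l.
  by rewrite lt_min => /andP[/tw -> /uw ->].
have aux (l m' : int) (n K j : nat) :
    l < m' + n.+1%:Z -> (j < K)%N -> l - K%:Z + j%:Z < m' + n%:Z by lia.
have step (n : nat) : forall l : int, l < m + n%:Z -> t l = u l.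
  elim: n => [|n IH] l; first by rewrite addr0; apply: lt_m.
  case: (ltP l (m + n%:Z)) => [/IH //|h1 h2].
  have := congr1 (fun h : int -> F => h (l - (size p).-1%:Z)) E.
  have sp : size p = (size p).-1.+1 by rewrite prednK// size_poly_gt0.
  rewrite !laurent_mul_polyE sp !big_ord_recr /=.
  rewrite (eq_bigr (fun j : 'I_(size p).-1 =>
    p`_j * u (l - (size p).-1%:Z + j%:Z))); last first.
    by move=> j _; rewrite IH//; apply: aux h2 (ltn_ord j).
  move=> /addrI; rewrite !subrK => /mulfI; apply.
  by rewrite -lead_coefE lead_coef_eq0.
have aux' (l m' : int) : l < m' + (absz (l - m' + 1))%:Z by lia.
by apply/funext => l; apply: step (aux' l m).
Qed.

Lemma coef_divp_mulXn f p N k : p != 0 ->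
  ((f * 'X^N) %/ p)`_(k + N) = (f %/ p)`_k.
Proof.
move=> p0.
have -> : (f * 'X^N) %/ p = (f %/ p) * 'X^N + ((f %% p) * 'X^N) %/ p.
  by rewrite {1}(divp_eq f p) mulrDl mulrAC divpD mulpK.
rewrite coefD coefMXn ltnNge leq_addl /= addnK.
rewrite [X in _ + X]nth_default ?addr0//.
rewrite size_divp// leq_subLR.
apply: leq_trans (size_polyMleq _ _) _; rewrite size_polyXn addnS /=.
by rewrite addnA leq_add2r (leq_trans _ (leq_addr _ _))//
  -ltnS prednK ?size_poly_gt0// ltn_modpN0.
Qed.

(* Expansion of f / p by long division. *)
Lemma laurent_div_polyE f p : p != 0 ->
  laurent (laurent_div (laurent_poly f) (laurent_poly p)) /\
  laurent_mul (laurent_poly p) (laurent_div (laurent_poly f) (laurent_poly p))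
    = laurent_poly f /\
  forall l : nat,
    laurent_div (laurent_poly f) (laurent_poly p) l%:Z
      = ((f * 'X^l) %/ p)`_0.
Proof.
move=> p0.
pose t (l : int) := if 0 <= l then ((f * 'X^(`|l|%N)) %/ p)`_0
                    else (f %/ p)`_(`|l|%N).
have tE (N k : nat) (l : int) : l = N%:Z - k%:Z -> t l = ((f * 'X^N) %/ p)`_k.
  move=> ->; rewrite /t; case: ifPn => h.
    have -> : `|N%:Z - k%:Z|%N = (N - k)%N by lia.
    rewrite -(@coef_divp_mulXn _ _ k)// -mulrA -exprD add0n subnK//; lia.
  rewrite -(@coef_divp_mulXn _ _ N)//.
  by congr (_ `_ _); lia.
have tL : laurent t.
  exists (- (size (f %/ p))%:Z) => l hl; rewrite /t ifF; last by lia.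
  have aux (n : nat) : l < - n%:Z -> (n <= `|l|)%N by lia.
  by rewrite nth_default// aux.
have tM : laurent_mul (laurent_poly p) t = laurent_poly f.
  apply/funext => l; rewrite laurent_mul_polyE.
  have [N [k [kE pk]]] : exists N k : nat, k%:Z = N%:Z - l /\ (size p <= k)%N.
    move: (size p) => n; exists (n + `|l|)%N, (absz ((n + `|l|)%N%:Z - l)).
    by split; lia.
  have fr := congr1 (fun g : {poly F} => g`_k) (divp_eq (f * 'X^N) p).
  rewrite /= coefD [X in _ + X]nth_default ?addr0 in fr; last first.
    by apply: leq_trans pk; apply/ltnW/ltn_modpN0.
  rewrite coefMXn mulrC coefM in fr.
  have -> : laurent_poly f l = if (k < N)%N then 0 else f`_(k - N).
    rewrite /laurent_poly; case: ifPn => hl.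
      by rewrite ifF; [congr (_ `_ _)|]; lia.
    by rewrite ifT//; lia.
  rewrite fr (big_ord_widen k.+1 (fun j => p`_j * t (l + j%:Z))); last exact: leqW.
  rewrite big_mkcond /=; apply: eq_bigr => j _.
  case: ifPn => hj; last by rewrite nth_default ?mul0r// leqNgt.
  by rewrite (@tE N (k - j)%N)//; have := ltn_ord j; lia.
have dE : laurent_div (laurent_poly f) (laurent_poly p) = t.
  apply: xget_unique; first by split.
  by move=> u [uL uM]; apply: (laurent_div_unique p0) => //; rewrite uM tM.
by rewrite dE; split=> //; split=> // l.
Qed.

End Laurent.

Section PolynomialLattice.
Variables (R : realType) (b m s alpha d : nat).
Implicit Types (u : {set 'I_(d * s)}) (k : {ffun 'I_(d * s) -> nat}).

Definition digit (n i : nat) : nat := ((n %/ b ^ i) %% b)%N.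

(* The bound n suffices: for b > 1, digits of index i >= n vanish. *)
Definition poly_of_nat (n : nat) : {poly 'F_b} :=
  \poly_(i < n) (digit n i)%:R.

Definition tr (n : nat) : {poly 'F_b} := \poly_(i < m) (digit n i)%:R.

Definition vmap (t : int -> 'F_b) : R :=
  \sum_(1 <= l < m.+1) (nat_of_ord (t l%:Z))%:R * b%:R ^- l.

Definition lattice_point (q : 'I_(d * s) -> {poly 'F_b}) (p : {poly 'F_b})
    (n : nat) (i : 'I_(d * s)) : R :=
  vmap (laurent_div (laurent_poly (poly_of_nat n * q i)) (laurent_poly p)).

Definition dual_lattice (q : 'I_(d * s) -> {poly 'F_b}) (p : {poly 'F_b}) :
    set {ffun 'I_(d * s) -> nat} :=
  [set k | p %| \sum_j tr (k j) * q j].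

(* For b > 1 and k > 0, b ^ (mu k).-1 <= k < b ^ mu k. *)
Definition mu (k : nat) : nat := (trunc_log b k).+1.

Definition r_weight1 (k : nat) : R :=
  if k == 0%N then 1
  else (b%:R - 1) *
    b%:R ^ (- ((2 * minn alpha d + 1) * mu k)%N%:Z - alpha%:Z + 1).

Definition r_weight k : R := \prod_j r_weight1 (k j).

(* Coordinates are numbered from 0: coordinate i * d + l, with l < d, is the
   l-th one of block i. *)
Definition block (i : 'I_s) : {set 'I_(d * s)} :=
  [set j : 'I_(d * s) | (i * d <= j < i.+1 * d)%N]%SET.

Lemma coord_idx_subproof (i : 'I_s) (l : 'I_d) : (i * d + l < d * s)%N.
Proof.
by have := ltn_ord i; have := ltn_ord l; nia.
Qed.

Definition coord_idx (i : 'I_s) (l : 'I_d) : 'I_(d * s) :=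
  Ordinal (coord_idx_subproof i l).

Definition vset u : {set 'I_s} :=
  [set i | u :&: block i != finset.set0]%SET.

Definition Dconst : R := (4 ^ (d - alpha) * b ^ ((2 * d - 1) * alpha))%N%:R.

Definition floor_logb (z : R) : int := Num.floor (ln z / ln b%:R).

Definition phi (z : R) : R :=
  let a := minn alpha d in
  let e := if z == 0 then 0 else b%:R ^ ((2 * a)%N%:Z * floor_logb z) in
  (b%:R - 1) * (b%:R - 1 - e * (b%:R ^+ (2 * a + 1) - 1))
  / (b%:R ^+ alpha * (b%:R ^+ (2 * a) - 1)).

(* The vectors (k_u, 0) with k_u in N^|u|: positive on u, zero off u. *)
Definition padded u : set {ffun 'I_(d * s) -> nat} :=
  [set k | forall j, (0 < k j)%N = (j \in u)].

(* The inner sums have nonnegative terms and are taken in [0, +oo], so that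
   B_quality = x%:E for a real x includes their convergence whenever their
   coefficient is nonzero. *)
Definition B_quality (gamma : {set 'I_s} -> R) (q : 'I_(d * s) -> {poly 'F_b})
    (p : {poly 'F_b}) : \bar R :=
  (\sum_(u : {set 'I_(d * s)} | u != finset.set0)
    (gamma (vset u) * Dconst ^+ #|vset u|)%:E *
    \esum_(k in padded u `&` dual_lattice q p) (r_weight k)%:E)%E.

End PolynomialLattice.

(* Main.v *)
(* For a character of F_b extended to Walsh functions, the average of
   wal_k(z_n) over the lattice points is the indicator of the dual lattice.
   Hence the sum of the weights r over the dual vectors with all k_j < b^N
   factors, for each n, into one-dimensional kernels
   sum_(0 < k < b^N) r(k) wal_k(z). Because r depends only on the number of
   digits of k, each kernel is an explicit telescoping sum which tends to
   phi(z) as N grows. Letting N go to infinity gives the inner sum of B for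
   each u, and the sum over u is regrouped according to v(u) by expanding
   products of the form prod (1 + phi). *)

Require Import Defs.
From mathcomp Require Import all_boot all_order all_algebra.
From mathcomp Require Import all_classical all_reals all_analysis.
From mathcomp Require Import zify ring lra complex.

Set Implicit Arguments.
Unset Strict Implicit.
Unset Printing Implicit Defensive.

Import Order.TTheory GRing.Theory Num.Theory.
Import numFieldNormedType.Exports.

Local Open Scope ring_scope.

(** * Base-[b] digits of integers *)

Lemma sum_ord_mul (V : nmodType) (A B : nat) (f : nat -> V) :
  \sum_(n < A * B) f n = \sum_(i < A) \sum_(j < B) f (i * B + j)%N.
Proof.
elim: A => [|A IH]; first by rewrite mul0n !big_ord0.
rewrite big_ord_recr /= -IH -!(big_mkord predT) (@big_cat_nat _ _ _ (A * B))//=.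
  congr (_ + _); rewrite mulSn -{1}[(A * B)%N]add0n big_addn addnK.
  by rewrite big_mkord; apply: eq_bigr => j _; rewrite addnC.
by rewrite leq_mul2r leqnSn orbT.
Qed.

Lemma digit_addl (b i j a l : nat) : (i < a)%N -> (0 < b)%N ->
  digit b (l * b ^ a + j) i = digit b j i.
Proof.
move=> ia b0; rewrite /digit -(subnK ia) expnD expnS !mulnA.
by rewrite divnMDl ?expn_gt0 ?b0// modnMDl.
Qed.

Lemma digit_addr (b j a l : nat) : (j < b ^ a)%N -> (l < b)%N ->
  digit b (l * b ^ a + j) a = l.
Proof.
move=> jb lb; rewrite /digit divnMDl; last by apply: leq_trans jb.
by rewrite divn_small// addn0 modn_small.
Qed.

Lemma digit_small (b n i : nat) : (n < b ^ i)%N -> digit b n i = 0%N.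
Proof. by move=> nb; rewrite /digit divn_small// mod0n. Qed.

(** * Orthogonality of additive characters of ['F_b] *)

Section Character.
Variables (b : nat) (b_prime : prime b) (F : numFieldType) (w : F).
Hypothesis w_sum : \sum_(i < b) w ^+ i = 0.

Let w_expb : w ^+ b = 1.
Proof. by apply/eqP; rewrite -subr_eq0 subrX1 w_sum mulr0. Qed.

(** By [w_sum], [w] is a [b]-th root of unity, and it differs from 1 because [F] has characteristic
    0. This is therefore a nontrivial additive character. *)
Definition char (x : 'F_b) : F := w ^+ (x : nat).

Lemma char_modn n : w ^+ (n %% b) = w ^+ n.
Proof. by rewrite {2}(divn_eq n b) exprD mulnC exprM w_expb expr1n mul1r. Qed.

Lemma charD x y : char (x + y) = char x * char y.
Proof.
by rewrite /char -exprD -[in RHS]char_modn /= [X in (_ %% X)%N]Fp_cast.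
Qed.

Lemma char0 : char 0 = 1. Proof. by []. Qed.

Lemma char_sum I (r : seq I) (P : pred I) (f : I -> 'F_b) :
  char (\sum_(i <- r | P i) f i) = \prod_(i <- r | P i) char (f i).
Proof. exact: (big_morph char charD char0). Qed.

(** For [c != 0], multiplication by [c] permutes the field, so the sum is the sum of all powers of
    [w] in [w_sum]. *)
Lemma sum_char_mul (c : 'F_b) :
  \sum_(k < b) char (k%:R * c) = if c == 0 then b%:R else 0.
Proof.
have b0 : (0 < b)%N by apply: prime_gt0.
have -> : \sum_(k < b) char (k%:R * c) = \sum_(x : 'F_b) char (x * c).
  rewrite -(big_mkord predT (fun k : nat => char (k%:R * c))).
  rewrite -[X in \sum_(0 <= i < X) _](Fp_cast b_prime) big_mkord.
  apply: eq_bigr => x _; congr (char (_ * _)); apply/val_inj => /=.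
  by rewrite val_Fp_nat// modn_small// -[X in (_ < X)%N](Fp_cast b_prime).
case: eqVneq => [->|c0].
  under eq_bigr do rewrite mulr0 char0.
  by rewrite sumr_const card_Fp.
rewrite -(reindex (fun x : 'F_b => x * c) (P := xpredT) (F := char)) /=; last first.
  by exists (fun x => x / c) => x _; rewrite ?mulfK ?mulfVK.
apply: etrans w_sum; rewrite -(@big_mkord _ _ _ b predT (fun k : nat => w ^+ k)).
by rewrite -[X in _ = \sum_(0 <= i < X) _](Fp_cast b_prime) big_mkord.
Qed.

(** The digits of [n < b ^ a] run independently through the field, so the sum factors into one sum
    per digit; the induction splits off the leading digit. *)
Lemma sum_char_digits (a : nat) (c : nat -> 'F_b) :
  \sum_(n < b ^ a) char (\sum_(i < a) (digit b n i)%:R * c i) =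
  (b ^ a)%:R * [forall i : 'I_a, c i == 0]%:R.
Proof.
have b0 : (0 < b)%N by apply: prime_gt0.
transitivity (\prod_(i < a) (if c i == 0 then b%:R else 0 : F)); last first.
  case: (boolP [forall i : 'I_a, c i == 0]) => [/forallP H|].
    under eq_bigr => i _ do rewrite H.
    by rewrite prodr_const card_ord natrX mulr1.
  rewrite negb_forall mulr0 => /existsP[i ci].
  by rewrite (bigD1 i)//= (negPf ci) mul0r.
elim: a => [|a IH].
  by rewrite expn0 big_ord_recl !big_ord0 addr0 char0.
rewrite expnS (@sum_ord_mul _ b (b ^ a)%N
  (fun n => char (\sum_(i < a.+1) (digit b n i)%:R * c i))).
under eq_bigr => l _.
  under eq_bigr => j _.
    rewrite big_ord_recr /= digit_addr// charD.
    under eq_bigr => i _ do rewrite digit_addl//.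
    over.
  rewrite -mulr_suml IH.
  over.
by rewrite -mulr_sumr sum_char_mul big_ord_recr.
Qed.

End Character.

(** [R[i]] is algebraically closed, and the equation is monic of degree [b - 1] with all lower
    coefficients equal to 1. *)
Lemma exists_root_sum (R : realType) (b : nat) : (1 < b)%N ->
  exists w : R[i], \sum_(i < b) w ^+ i = 0.
Proof.
case: b => [//|b] /ltnSE b0.
have [w wE] := solve_monicpoly (fun=> -1 : R[i]) b0.
exists w; rewrite big_ord_recr /= wE -big_split /=.
by rewrite big1// => i _; rewrite mulN1r addrN.
Qed.

(** * Residues of fractions with denominator [p] *)

Section Residue.
Variables (b : nat) (b_prime : prime b) (p : {poly 'F_b}) (m : nat).
Hypothesis deg_p : size p = m.+1.

(* The coefficient of x^(-1) in f / p. *)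
Definition residue (f : {poly 'F_b}) : 'F_b := ((f * 'X) %/ p)`_0.

Lemma residueD f g : residue (f + g) = residue f + residue g.
Proof. by rewrite /residue mulrDl divpD coefD. Qed.

Lemma residueZ c f : residue (c *: f) = c * residue f.
Proof. by rewrite /residue -scalerAl divpZl coefZ. Qed.

Lemma residue0 : residue 0 = 0.
Proof. by rewrite -[0](scale0r 0) residueZ mul0r. Qed.

Lemma residue_sum I (r : seq I) (P : pred I) (f : I -> {poly 'F_b}) :
  residue (\sum_(i <- r | P i) f i) = \sum_(i <- r | P i) residue (f i).
Proof. exact: (big_morph _ residueD residue0). Qed.

(** The residue pairing is nondegenerate modulo [p]: multiples of [p] have residue 0, and a nonzero
    remainder can be shifted by a power of ['X] until its residue is visible. *)
Lemma residue_eq0 (K : {poly 'F_b}) :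
  [forall i : 'I_m, residue ('X^i * K) == 0] = (p %| K).
Proof.
have p0 : p != 0 by rewrite -size_poly_eq0 deg_p.
have dvd0 f i : residue ('X^i * (f * p)) = 0.
  by rewrite /residue mulrAC mulrA mulpK// mulrAC coefMX.
have E i : residue ('X^i * K) = residue ('X^i * (K %% p)).
  by rewrite {1}(divp_eq K p) mulrDr residueD dvd0 add0r.
apply/forallP/idP => [H|/dvdpP[f ->] i]; last by rewrite dvd0.
apply: contraT => nd; set r := K %% p in E.
(* X^(m - size r) * r has degree m - 1, so its residue is not zero. *)
have r0 : r != 0 by [].
have sr : (size r < m.+1)%N by rewrite -deg_p ltn_modp.
have sr0 : (0 < size r)%N by rewrite size_poly_gt0.
have im : (m - size r < m)%N by lia.
move: (H (Ordinal im)) => /=; rewrite E /residue.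
set g := _ * 'X => /eqP g0.
have sg : size g = m.+1.
  rewrite /g size_mulX; last by rewrite mulf_neq0// -size_poly_eq0 size_polyXn.
  by rewrite mulrC size_mulXn// subnK.
have s1 : size (g %/ p) = 1%N by rewrite size_divp// sg deg_p subSnn.
move: s1 => /eqP/size_poly1P[c c0 gp].
by move: g0; rewrite gp coefC /= => cc; rewrite cc eqxx in c0.
Qed.

Lemma residue_poly_of_nat a (n : nat) (K : {poly 'F_b}) : (n < b ^ a)%N ->
  residue (poly_of_nat b n * K) =
  \sum_(i < a) (digit b n i)%:R * residue ('X^i * K).
Proof.
move=> na.
have b1 := prime_gt1 b_prime.
(* [poly_of_nat] is cut off at [n] and the new sum at [a]; the digits of [n] vanish beyond either
   bound. *)
have -> : poly_of_nat b n = \sum_(i < a) (digit b n i)%:R *: 'X^i.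
  rewrite -(poly_def a (fun i => (digit b n i)%:R)).
  apply/polyP => i; rewrite !coef_poly.
  case: ltnP => hi; case: ltnP => hj //.
    by rewrite digit_small// (leq_trans na)// leq_exp2l.
  by rewrite digit_small// (leq_ltn_trans hi)// ltn_expl.
rewrite mulr_suml residue_sum; apply: eq_bigr => i _.
by rewrite -scalerAl residueZ.
Qed.

End Residue.

(** * One-dimensional Walsh kernels and their limit *)

Lemma eq_sum_ord_support (V : nmodType) (n m : nat) (f : nat -> V) :
  (forall i, (n <= i)%N || (m <= i)%N -> f i = 0) ->
  \sum_(i < n) f i = \sum_(i < m) f i.
Proof.
wlog nm : n m / (n <= m)%N => [H f0|f0].
  case/orP: (leq_total n m) => nm; first exact: H.
  by apply/esym/H => // i; rewrite orbC; apply: f0.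
rewrite (big_ord_widen m f nm) big_mkcond; apply: eq_bigr => i _.
by case: ltnP => // ni; rewrite f0// ni.
Qed.

Definition zeros (b : nat) (c : nat -> 'F_b) (a : nat) : bool :=
  [forall i : 'I_a, c i == 0].

Section Kernel.
Variables (R : realType) (b m alpha d : nat) (b_prime : prime b).
Hypotheses (alpha_gt0 : (0 < alpha)%N) (d_gt0 : (0 < d)%N).
Implicit Types (c : nat -> 'F_b) (t : int -> 'F_b).

Local Notation A := (minn alpha d).
Local Notation x := (b%:R ^- (2 * A) : R).

(** For [a > 0], the common value of [r_weight1] on the integers with exactly [a] digits. *)
Definition level_weight (a : nat) : R :=
  (b%:R - 1) * b%:R ^ (- ((2 * A + 1) * a)%N%:Z - alpha%:Z + 1).

(* The value of sum_(0 < k < b^N) r(k) wal_k at a point with digits [c]; the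
   summand [a] collects the k with [a + 1] digits. *)
Definition kernel_sum c (N : nat) : R :=
  \sum_(a < N) level_weight a.+1 *
    ((b ^ a.+1)%:R * (zeros c a.+1)%:R - (b ^ a)%:R * (zeros c a)%:R).

Lemma r_weight1_ge0 k : 0 <= r_weight1 R b alpha d k.
Proof.
rewrite /r_weight1; case: ifP => // _; rewrite mulr_ge0//.
by rewrite subr_ge0 ler1n prime_gt0.
Qed.

(** The weight is constant on [b ^ N <= k < b ^ N.+1], and the character sum over this range is a
    difference of two complete sums, each known by orthogonality. *)
Lemma sum_r_weight1_char (w : R[i]) (w_sum : \sum_(i < b) w ^+ i = 0) c N :
  (forall i, (m <= i)%N -> c i = 0) ->
  \sum_(k < b ^ N | (0 < k)%N) (r_weight1 R b alpha d k)%:C%C *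
     char w (\sum_(i < m) (digit b k i)%:R * c i)
  = (kernel_sum c N)%:C%C.
Proof.
move=> c0; pose f k : R[i] := char w (\sum_(i < m) (digit b k i)%:R * c i).
have b1 := prime_gt1 b_prime.
have sumf M : \sum_(k < b ^ M) f k = ((b ^ M)%:R * (zeros c M)%:R)%:C%C.
  rewrite rmorphM !rmorph_nat /zeros -(sum_char_digits b_prime w_sum).
  apply: eq_bigr => k _; rewrite /f.
  (* The cut-off [m] may be replaced by [M]: [c] vanishes from [m] on, and the digits of [k] vanish
     from [M] on. *)
  rewrite (@eq_sum_ord_support _ _ M (fun i => (digit b k i)%:R * c i))// => i.
  case/orP => h; first by rewrite c0 ?mulr0.
  by rewrite digit_small ?mul0r// (leq_trans (ltn_ord k))// leq_exp2l.
rewrite -[LHS](big_mkord (fun k => 0 < k)%N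
  (fun k => (r_weight1 R b alpha d k)%:C%C * f k)).
elim: N => [|N IH].
  by rewrite expn0 big_mkcond big_nat1 /kernel_sum big_ord0.
have bN : (b ^ N <= b ^ N.+1)%N by rewrite leq_exp2l.
rewrite (@big_cat_nat _ _ _ (b ^ N)%N)//= IH /kernel_sum big_ord_recr /= rmorphD.
congr (_ + _); rewrite rmorphM rmorphB /= -!sumf.
rewrite -!(big_mkord predT) (@big_cat_nat _ _ _ (b ^ N)%N 0 (b ^ N.+1)%N)//=.
rewrite addrAC subrr add0r.
rewrite mulr_sumr big_nat_cond [RHS]big_nat_cond.
have b0 : (0 < b ^ N)%N by rewrite expn_gt0 prime_gt0.
apply: eq_big => [k|k /andP[/andP[Nk kN] _]].
  by case: (leqP (b ^ N) k) => //= h; rewrite (leq_trans b0 h) andbT.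
rewrite /r_weight1 /mu (@trunc_log_eq _ N)// ?Nk// ifF//.
by rewrite gtn_eqF// (leq_trans b0).
Qed.

Let b_gt1 : 1 < b%:R :> R. Proof. by rewrite ltr1n prime_gt1. Qed.
Let b_neq0 : b%:R != 0 :> R. Proof. by rewrite gt_eqF// (lt_trans ltr01). Qed.

Lemma ratio_itv : 0 < x < 1.
Proof.
have b0 : 0 < b%:R :> R by apply: lt_trans b_gt1.
rewrite invr_gt0 exprn_gt0//= invf_lt1 ?exprn_gt0// exprn_egt1//.
by rewrite muln_eq0 /= -lt0n leq_min alpha_gt0.
Qed.

(** The factor [b ^ a] absorbs the [+ 1] in the exponent [2 * A + 1], which leaves a geometric
    sequence in [x]. *)
Lemma level_weightE a :
  level_weight a.+1 * (b ^ a)%:R = (b%:R - 1) * b%:R ^- alpha * x ^+ a.+1.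
Proof.
rewrite /level_weight -[X in X = _]mulrA -[X in _ = X]mulrA; congr (_ * _).
rewrite natrX exprVn -exprM !exprnN -[(b%:R ^+ a)]/(b%:R ^ a%:Z).
rewrite -!expfzDr//; congr (_ ^ _).
lia.
Qed.

Lemma zerosS c a : zeros c a.+1 = zeros c a && (c a == 0).
Proof.
apply/forallP/andP => [H|[/forallP H ca] i].
  by split; [apply/forallP => i; have := H (widen_ord (leqnSn a) i)|
             have := H ord_max].
have := ltn_ord i; rewrite ltnS leq_eqVlt => /orP[/eqP->//|ia].
exact: (H (Ordinal ia)).
Qed.

(** All indicators are 1, so the sum is geometric with ratio [x]. *)
Lemma kernel_sum_zeros c N : zeros c N ->
  kernel_sum c N = (b%:R - 1) ^+ 2 * b%:R ^- alpha * (x * (1 - x ^+ N) / (1 - x)).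
Proof.
have /andP[_ x1] := ratio_itv.
have x1' : 1 - x != 0 by rewrite subr_eq0 gt_eqF.
elim: N => [|N IH]; first by rewrite /kernel_sum big_ord0 expr0 subrr !(mulr0, mul0r).
rewrite zerosS => cN; have /andP[cN' _] := cN.
rewrite /kernel_sum big_ord_recr /= -/(kernel_sum c N) (IH cN') zerosS cN cN'.
have -> : (b ^ N.+1)%:R * true%:R - (b ^ N)%:R * true%:R
    = (b%:R - 1) * (b ^ N)%:R :> R by rewrite expnS natrM !mulr1; ring.
rewrite [X in _ + X]mulrCA level_weightE.
by rewrite !exprS; set y := x in x1' *; field; rewrite x1' ?expf_neq0.
Qed.

(** Below the first nonzero digit the sum is geometric; the summand [a] keeps only its negative
    term, and all later ones vanish. The value no longer depends on [N]. *)
Lemma kernel_sum_first c a N : zeros c a -> c a != 0 -> (a < N)%N ->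
  kernel_sum c N = (b%:R - 1) * b%:R ^- alpha *
    (((b%:R - 1) * x - x ^+ a.+1 * (b%:R - x)) / (1 - x)).
Proof.
have /andP[_ x1] := ratio_itv.
have x1' : 1 - x != 0 by rewrite subr_eq0 gt_eqF.
move=> ca ca0; elim: N => // N IH; rewrite ltnS leq_eqVlt => /orP[/eqP <-|aN].
  rewrite /kernel_sum big_ord_recr /= -/(kernel_sum c a) kernel_sum_zeros//.
  rewrite zerosS ca (negPf ca0) /= mulr0 mulr1 sub0r mulrN level_weightE.
  by rewrite !exprS; set y := x in x1' *; field; rewrite x1' ?expf_neq0.
rewrite /kernel_sum big_ord_recr /= -/(kernel_sum c N) (IH aN).
have z0 M : (a < M)%N -> zeros c M = false.
  by move=> aM; apply/negP => /forallP/(_ (Ordinal aM)) /=; rewrite (negPf ca0).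
by rewrite !z0//; [rewrite !mulr0 subrr mulr0 addr0|exact: ltnW].
Qed.

(** Index [i] holds the coefficient of x^(-(i+1)), because the expansion of a point starts at
    x^(-1); the cut-off at [m] is that of [vmap]. *)
Definition digits_of t (i : nat) : 'F_b := if (i < m)%N then t i.+1%:Z else 0.

Lemma vmap_digits t :
  vmap R m t = \sum_(i < m) (digits_of t i)%:R * b%:R ^- i.+1.
Proof.
rewrite /vmap big_add1 /= big_mkord; apply: eq_bigr => i _.
by rewrite /digits_of ltn_ord.
Qed.

Lemma digits_val_le (c : 'F_b) : (c : nat)%:R <= b%:R - 1 :> R.
Proof.
rewrite lerBrDr natr1 ler_nat.
by rewrite -[X in (_ <= X)%N](Fp_cast b_prime).
Qed.

(** Each digit is at most [b - 1], and the resulting geometric sum telescopes. *)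
Lemma sum_digits_bounds c a M : zeros c a -> (a <= M)%N ->
  \sum_(i < M) (c i : nat)%:R * b%:R ^- i.+1 <= b%:R ^- a - b%:R ^- M :> R.
Proof.
move=> ca; elim: M => [|M IH].
  by rewrite leqn0 => /eqP->; rewrite big_ord0 subrr.
rewrite leq_eqVlt => /orP[/eqP <-|aM].
  by rewrite subrr big1// => i _; move/forallP: ca => /(_ i)/eqP->; rewrite mul0r.
rewrite big_ord_recr /=; apply: le_trans (lerD (IH aM) _) _.
  by apply: ler_wpM2r (digits_val_le _); rewrite invr_ge0 exprn_ge0.
by rewrite mulrBl mul1r exprS invfM mulVKf//; lra.
Qed.

(** The first nonzero digit places [z] in the interval [b^(-(a+1)), b^(-a)). *)
Lemma floor_logb_first c a : zeros c a -> c a != 0 -> (a < m)%N ->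
  let z := \sum_(i < m) (c i : nat)%:R * b%:R ^- i.+1 : R in
  (0 < z) /\ floor_logb b z = - (a.+1%:Z).
Proof.
move=> ca ca0 am z.
have b0 : 0 < b%:R :> R by apply: lt_trans b_gt1.
have zlt : z < b%:R ^- a.
  apply: le_lt_trans (sum_digits_bounds ca (ltnW am)) _.
  by rewrite ltrBlDr ltrDl invr_gt0 exprn_gt0.
have zge : b%:R ^- a.+1 <= z.
  rewrite /z (bigD1 (Ordinal am))//= -[X in X <= _]addr0 lerD//.
    rewrite -[X in X <= _]mul1r ler_wpM2r ?invr_ge0 ?exprn_ge0//.
    by rewrite ler1n lt0n.
  by apply: sumr_ge0 => i _; rewrite mulr_ge0// invr_ge0 exprn_ge0.
have z0 : 0 < z by apply: lt_le_trans zge; rewrite invr_gt0 exprn_gt0.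
split=> //; rewrite /floor_logb; apply: floor_def.
have lb : 0 < ln b%:R :> R by apply: ln_gt0.
have lnb n : ln (b%:R ^- n) = - (n%:R * ln b%:R) :> R.
  by rewrite lnV ?posrE ?exprn_gt0// lnXn// mulr_natl.
rewrite ler_pdivlMr// ltr_pdivrMr//; apply/andP; split.
  by rewrite mulrNz mulNr -pmulrn -lnb ler_ln ?posrE ?invr_gt0 ?exprn_gt0.
have -> : - a.+1%:Z + 1 = - (a%:Z) by lia.
by rewrite mulrNz mulNr -pmulrn -lnb ltr_ln ?posrE ?invr_gt0 ?exprn_gt0.
Qed.

Lemma kernel_sum_cvg t :
  (kernel_sum (digits_of t) n @[n --> \oo] --> phi b alpha d (vmap R m t))%classic.
Proof.
have /andP[x0 x1] := ratio_itv.
have x1' : 1 - x != 0 by rewrite subr_eq0 gt_eqF.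
have xV : b%:R ^+ (2 * A) = x^-1 by rewrite invrK.
set c := digits_of t.
have [cz|] := boolP (zeros c m).
  have zN N : zeros c N.
    apply/forallP => i; rewrite /c /digits_of; case: ltnP => // im.
    by move/forallP: cz => /(_ (Ordinal im)); rewrite /c /digits_of /= im.
  (* At the point 0, the convention that the power of [b] in [phi] is 0 matches the limit 0 of
     [x ^+ N]. *)
  have -> : phi b alpha d (vmap R m t) =
      (b%:R - 1) ^+ 2 * b%:R ^- alpha * (x * (1 - 0) / (1 - x)).
    rewrite vmap_digits big1 => [|i _]; last first.
      by move/forallP: cz => /(_ i); rewrite /c => /eqP ->; rewrite mul0r.
    rewrite /phi eqxx mul0r subr0 xV.
    set y := x in x0 x1' *; field.
    by rewrite gt_eqF//= x1' expf_neq0.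
  have -> : kernel_sum c = fun N =>
      (b%:R - 1) ^+ 2 * b%:R ^- alpha * (x * (1 - x ^+ N) / (1 - x)).
    by apply/funext => N; rewrite kernel_sum_zeros.
  apply: cvgMr; apply: cvgMl; apply: cvgMr; apply: cvgB; first exact: cvg_cst.
  by apply: cvg_expr; rewrite gtr0_norm.
rewrite negb_forall => /existsP[i0 ci0].
pose P n := (n < m)%N && (c n != 0).
have exP : exists n, P n by exists i0; rewrite /P ltn_ord.
have [a /andP[am ca0] amin] := ex_minnP exP.
have ca : zeros c a.
  apply/forallP => i; apply: contraT => ci.
  have := amin i; rewrite /P ci (ltn_trans (ltn_ord i) am) => /(_ isT).
  by rewrite leqNgt ltn_ord.
have [z0 zf] := floor_logb_first ca ca0 am.
rewrite -vmap_digits in z0 zf.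
have -> : phi b alpha d (vmap R m t) = (b%:R - 1) * b%:R ^- alpha *
    (((b%:R - 1) * x - x ^+ a.+1 * (b%:R - x)) / (1 - x)).
  rewrite /phi gt_eqF// zf mulrN -PoszM -exprnN exprM -exprVn exprD xV expr1.
  set y := x in x0 x1' *; field.
  by rewrite gt_eqF//= x1' expf_neq0.
(* At a nonzero point the kernel sums are constant once [N] exceeds the position of the first
   nonzero digit. *)
apply: cvg_near_cst; exists a.+1 => // N /= aN.
exact: kernel_sum_first.
Qed.

End Kernel.

(** * Sums over the dual lattice as limits of finite sums *)

Lemma esum_exhaust (R : realType) (T : choiceType) (S : set T) (a : T -> R)
    (B : nat -> set T) (l : R) :
  (forall x, 0 <= a x) -> (forall N, finite_set (B N)) ->
  (forall N, B N `<=` S)%classic ->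
  (forall X, finite_set X -> (X `<=` S)%classic ->
    \forall N \near \oo%classic, (X `<=` B N)%classic) ->
  ((\sum_(x \in B N) a x)%R @[N --> \oo] --> l)%classic ->
  \esum_(x in S) (a x)%:E = l%:E.
Proof.
move=> a0 finB BS BX cvl.
have cvle : ((\sum_(x \in B N) a x)%R%:E @[N --> \oo] --> l%:E)%classic.
  by apply: cvg_EFin => //; apply: nearW.
apply/eqP; rewrite eq_le; apply/andP; split.
  (* Upper bound: a finite [X] eventually lies in [B N], so its partial sum is at most the limit. *)
  apply: ge_ereal_sup => _ [X [finX XS] <-].
  rewrite fsumEFin// lee_fin.
  apply: (cvgr_to_ge cvl); have := BX X finX XS; apply: filterS => N XB.
  rewrite -lee_fin -!fsumEFin//; apply: lee_fsum_nneg_subset => //.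
    by move=> x; rewrite !inE; apply: XB.
  by move=> x _; rewrite lee_fin.
(* Lower bound: each [B N] is itself a finite subset of [S]. *)
apply: (cvge_to_le cvle); apply: nearW => N.
rewrite -fsumEFin//; apply: esum_ge; exists (B N) => //.
Qed.

Section DualLattice.
Variables (R : realType) (b m s alpha d : nat) (b_prime : prime b).
Hypotheses (alpha_gt0 : (0 < alpha)%N) (d_gt0 : (0 < d)%N).
Variables (p : {poly 'F_b}) (q : 'I_(d * s) -> {poly 'F_b}).
Hypothesis deg_p : size p = m.+1.

Local Notation I := ('I_(d * s)).

Let lattice_digits (n : nat) (j : I) : nat -> 'F_b :=
  digits_of m
    (laurent_div (laurent_poly (poly_of_nat b n * q j)) (laurent_poly p)).

(** The product over [j] is the character of the residue of [n] times the combination of the [q j].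
    Orthogonality over the digits of [n] tests all shifted residues, hence divisibility by [p]. *)
Lemma sum_char_dual (w : R[i]) (w_sum : \sum_(i < b) w ^+ i = 0)
    (k : I -> nat) :
  \sum_(n < b ^ m) \prod_j
    char w (\sum_(i < m) (digit b (k j) i)%:R * lattice_digits n j i)
  = (b ^ m)%:R * (p %| \sum_j tr b m (k j) * q j)%R%:R.
Proof.
have p0 : p != 0 by rewrite -size_poly_eq0 deg_p.
set K := \sum_j tr b m (k j) * q j; rewrite -(residue_eq0 b_prime deg_p K).
rewrite -(sum_char_digits b_prime w_sum m (fun i => residue p ('X^i * K))).
apply: eq_bigr => n _.
rewrite -(char_sum b_prime w_sum) -(residue_poly_of_nat b_prime)//.
congr (char w _); rewrite /K mulr_sumr residue_sum; apply: eq_bigr => j _.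
rewrite mulrCA /tr poly_def mulr_suml residue_sum; apply: eq_bigr => i _.
rewrite -scalerAl residueZ /lattice_digits /digits_of ltn_ord; congr (_ * _).
(* Long division identifies the coefficient of x^(-(i+1)) with a residue after multiplication by
   ['X^i]. *)
have [_ [_ ->]] := laurent_div_polyE (poly_of_nat b n * q j) p0.
by rewrite /residue mulrC exprS; congr ((_ %/ p)`_0); ring.
Qed.

Definition box (u : {set I}) (N : nat) : set {ffun I -> nat} :=
  ([set k : {ffun I -> nat} | forall j, (k j < b ^ N)%N] `&`
   (padded u `&` dual_lattice m q p))%classic.

Definition unbox N (f : {ffun I -> 'I_(b ^ N)}) : {ffun I -> nat} :=
  [ffun j => f j : nat].

(** The boolean form of [box] on a finite type of functions, where products of sums can be
    expanded. *)
Definition in_box (u : {set I}) N : pred {ffun I -> 'I_(b ^ N)} :=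
  fun f => [forall j, (0 < f j)%N == (j \in u)] &&
           (p %| \sum_j tr b m (f j) * q j).

Lemma box_bij u N :
  set_bij [set` @in_box u N]%classic (box u N) (@unbox N).
Proof.
split.
- move=> f /andP[/forallP fu pf]; split=> [j|]; first by rewrite ffunE.
  split=> [j|]; first by rewrite ffunE; have /eqP := fu j.
  rewrite /dual_lattice /=.
  by under eq_bigr do rewrite ffunE.
- move=> f g _ _ /ffunP fg; apply/ffunP => j; apply/val_inj.
  by have := fg j; rewrite !ffunE.
- move=> k [kN [ku kd]]; exists [ffun j => Ordinal (kN j)].
    rewrite /= /in_box; apply/andP; split.
      by apply/forallP => j; rewrite ffunE /= ku.
    by rewrite /dual_lattice /= in kd; under eq_bigr do rewrite ffunE.
  by apply/ffunP => j; rewrite !ffunE.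
Qed.

(** The indicator of the dual lattice is an average of characters over [n]; for fixed [n] the sum
    over the box then factors over the coordinates. *)
Lemma sum_box u N :
  \sum_(k \in box u N) r_weight R b alpha k =
  (b ^ m)%:R^-1 * \sum_(n < b ^ m) \prod_(j in u)
     kernel_sum R alpha d (lattice_digits n j) N.
Proof.
have b1 := prime_gt1 b_prime.
have [w w_sum] := exists_root_sum R b1.
have bm0 : (b ^ m)%:R != 0 :> R by rewrite pnatr_eq0 -lt0n expn_gt0 prime_gt0.
rewrite (reindex_fsbig _ _ _ _ (box_bij u N)).
rewrite -(bigfs _ (r := index_enum _)) ?index_enum_uniq//; last first.
  by move=> f _; rewrite mem_index_enum.
apply/(mulfI bm0); rewrite mulVKf//.
(* Characters take complex values, so the identity is proved in [R[i]] and pulled back by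
   injectivity. *)
apply: (@complexI R).
transitivity (\sum_(n < b ^ m) \prod_j
    \sum_(k < b ^ N | (0 < k)%N == (j \in u)) (r_weight1 R b alpha d k)%:C%C *
     char w (\sum_(i < m) (digit b k i)%:R * lattice_digits n j i)); last first.
  rewrite rmorph_sum; apply: eq_bigr => n _; rewrite rmorph_prod.
  rewrite [RHS]big_mkcond; apply: eq_bigr => j _ /=.
  case: ifP => ju.
    rewrite -(sum_r_weight1_char alpha d b_prime w_sum N (m := m)).
      by apply: eq_bigl => k; rewrite eqb_id.
    by move=> i mi; rewrite /lattice_digits /digits_of ltnNge mi.
  (* Off [u] only the entry 0 is allowed, and it contributes the factor 1. *)
  have bN : (0 < b ^ N)%N by rewrite expn_gt0 prime_gt0.
  rewrite (big_pred1 (Ordinal bN)) => [/=|k]; last first.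
    by rewrite eqbF_neg -eqn0Ngt.
  rewrite /r_weight1 eqxx big1 ?mulr1// => i _.
  by rewrite /digit div0n mod0n mul0r.
under [RHS]eq_bigr do rewrite bigA_distr_big_dep.
rewrite exchange_big /= rmorphM rmorph_nat rmorph_sum mulr_sumr /=.
rewrite big_mkcond [RHS]big_mkcond; apply: eq_bigr => f _.
rewrite /in_box; set c1 := [forall j, _]; set c2 := (p %| _).
have -> : (f \in family (fun j (k : 'I_(b ^ N)) => (0 < k)%N == (j \in u))) = c1 by [].
case: c1 => //=.
under eq_bigr do rewrite big_split /=.
rewrite -mulr_sumr.
rewrite (sum_char_dual w_sum (fun j => f j)) -/c2 /r_weight rmorph_prod mulrCA.
case: c2; rewrite ?mulr0// mulr1; congr (_ * _).
by apply: eq_bigr => j _; rewrite ffunE.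
Qed.

Lemma esum_dual_lattice (u : {set I}) :
  \esum_(k in (padded u `&` dual_lattice m q p)%classic)
    (r_weight R b alpha k)%:E =
  ((b ^ m)%:R^-1 * \sum_(n < b ^ m) \prod_(j in u)
     phi b alpha d (lattice_point R m q p n j))%:E.
Proof.
have b1 := prime_gt1 b_prime.
apply: (@esum_exhaust _ _ _ _ (box u)).
- by move=> k; apply: prodr_ge0 => j _; apply: r_weight1_ge0.
- move=> N; have [_ _ surj] := box_bij u N.
  apply: sub_finite_set surj _; apply: finite_image.
  exact: finite_finset.
- by move=> N k [].
- move=> X finX XS; pose M (k : {ffun I -> nat}) := (\max_j k j)%N.
  (* The largest entry of any vector in [X] is enough, because [n < b ^ n]. *)
  exists (\max_(k <- finmap.enum_fset (fset_set X)) M k)%N => // N /= XN k Xk.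
  split; last exact: XS.
  move=> j; apply: (leq_ltn_trans _ (ltn_expl N b1)).
  apply: leq_trans XN; apply: leq_trans (leq_bigmax j) _.
  apply: (@leq_bigmax_seq _ _ xpredT M) => //.
  by rewrite in_fset_set// inE.
rewrite (_ : (fun N => _) = fun N => (b ^ m)%:R^-1 * \sum_(n < b ^ m)
    \prod_(j in u) kernel_sum R alpha d (lattice_digits n j) N); last first.
  by apply/funext => N; rewrite sum_box.
apply: cvgMr; apply: cvg_big => [|n _]; first exact: add_continuous.
apply: cvg_big => [|j _]; first exact: mul_continuous.
exact: kernel_sum_cvg.
Qed.

End DualLattice.

(** * Regrouping sets of coordinates by the blocks they meet *)

Lemma prod_1D (R : comPzRingType) (I : finType) (f : I -> R) :
  \prod_i (1 + f i) = \sum_(w : {set I}) \prod_(i in w) f i.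
Proof.
under eq_bigr do rewrite addrC.
rewrite bigA_distr; apply: eq_bigr => w _.
by rewrite [LHS]/= -big_mkcond.
Qed.

Section Blocks.
Variables (R : comPzRingType) (d s : nat).

Lemma coord_idx_bij :
  bijective (fun ik : 'I_s * 'I_d => coord_idx ik.1 ik.2).
Proof.
have d0 (j : 'I_(d * s)) : (0 < d)%N.
  by case: d j => // -[]; rewrite mul0n.
have hi (j : 'I_(d * s)) : (j %/ d < s)%N.
  by rewrite ltn_divLR ?d0// [(s * d)%N]mulnC.
have hk (j : 'I_(d * s)) : (j %% d < d)%N by rewrite ltn_mod d0.
exists (fun j => (Ordinal (hi j), Ordinal (hk j))) => [[i k]|j].
  have d1 : (0 < d)%N by apply: leq_ltn_trans (ltn_ord k).
  congr pair; apply: val_inj => /=.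
    by rewrite divnMDl// divn_small// addn0.
  by rewrite modnMDl modn_small.
by apply: val_inj; rewrite /= -divn_eq.
Qed.

Lemma mem_vset (u : {set 'I_(d * s)}) (i : 'I_s) :
  (i \in vset u) = [exists k, coord_idx i k \in u].
Proof.
rewrite inE; apply/set0Pn/existsP => [[j]|[k ku]]; last first.
  exists (coord_idx i k); rewrite inE ku /= inE /= leq_addr /= mulSn addnC.
  by rewrite ltn_add2r ltn_ord.
rewrite !inE => /andP[ju /andP[ij ji]].
have kd : (j - i * d < d)%N by rewrite ltn_subLR// -mulSnr.
exists (Ordinal kd); rewrite (_ : coord_idx _ _ = j)//.
by apply: val_inj; rewrite /= subnKC.
Qed.

(** Such a [u] is a family of subsets of ['I_d], one per block, nonempty exactly for the blocks in
    [v]. Expanding the inner product gives all subsets, and the [-1] removes the empty one. *)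
Lemma sum_vset (x : 'I_(d * s) -> R) (v : {set 'I_s}) :
  \sum_(u : {set 'I_(d * s)} | vset u == v) \prod_(j in u) x j =
  \prod_(i in v) (-1 + \prod_(k < d) (1 + x (coord_idx i k))).
Proof.
transitivity (\prod_i \sum_(w : {set 'I_d} | (w != finset.set0) == (i \in v))
    \prod_(k in w) x (coord_idx i k)); last first.
  rewrite [RHS]big_mkcond; apply: eq_bigr => i _; case: ifP => iv.
    rewrite prod_1D [in RHS](bigD1 finset.set0)//= big_set0 addKr.
    by apply: eq_bigl => w; rewrite eqb_id.
  rewrite (big_pred1 finset.set0) ?big_set0// => w.
  by rewrite eqbF_neg negbK.
rewrite bigA_distr_big_dep.
pose split_blocks (u : {set 'I_(d * s)}) : {ffun 'I_s -> {set 'I_d}} :=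
  [ffun i => [set k | coord_idx i k \in u]%SET].
have [g coordK gK] := coord_idx_bij.
rewrite (reindex split_blocks) /=; last first.
  exists (fun f : {ffun 'I_s -> {set 'I_d}} =>
            [set j | (g j).2 \in f (g j).1]%SET) => [u _|f _].
    by apply/setP => j; rewrite !inE ffunE inE gK.
  by apply/ffunP => i; apply/setP => k; rewrite ffunE !inE (coordK (i, k)).
apply: eq_big => [u|u _].
  apply/eqP/familyP => [<- i|H].
    rewrite unfold_in ffunE mem_vset; apply/eqP; apply/set0Pn/existsP.
      by case=> k; rewrite inE => ku; exists k.
    by case=> k ku; exists k; rewrite inE.
  apply/setP => i; have := H i; rewrite unfold_in ffunE mem_vset => /eqP <-.
  apply/existsP/set0Pn.
    by case=> k ku; exists k; rewrite inE.
  by case=> k; rewrite inE => ku; exists k.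
rewrite (reindex (fun ik : 'I_s * 'I_d => coord_idx ik.1 ik.2)) /=; last first.
  by exists g => ? _; [apply: coordK|apply: gK].
rewrite -(pair_big_dep xpredT (fun i k => coord_idx i k \in u)
  (fun i k => x (coord_idx i k))) /=.
by apply: eq_bigr => i _; apply: eq_bigl => k; rewrite ffunE inE.
Qed.

Lemma sum_over_vset (G : {set 'I_s} -> R) (x : 'I_(d * s) -> R) :
  \sum_(u : {set 'I_(d * s)} | u != finset.set0) G (vset u) * \prod_(j in u) x j =
  \sum_(v : {set 'I_s} | v != finset.set0)
    G v * \prod_(i in v) (-1 + \prod_(k < d) (1 + x (coord_idx i k))).
Proof.
have [g coordK gK] := coord_idx_bij.
have vset_neq0 (u : {set 'I_(d * s)}) : (vset u != finset.set0) = (u != finset.set0).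
  apply/set0Pn/set0Pn => [[l]|[j ju]].
    by rewrite mem_vset => /existsP[k ku]; exists (coord_idx l k).
  exists (g j).1; rewrite mem_vset; apply/existsP; exists (g j).2.
  by rewrite gK.
rewrite (partition_big (@vset s d) (fun v => v != finset.set0)); last first.
  by move=> u; rewrite vset_neq0.
apply: eq_bigr => v v0; rewrite -sum_vset mulr_sumr; apply: eq_big => [u|u].
  by rewrite -vset_neq0; case: (vset u =P v) => [->|_]; rewrite ?v0 ?andbF.
by case/andP => _ /eqP ->.
Qed.

End Blocks.

Theorem lemma4 (R : realType) (b m s alpha d : nat)
  (b_prime : prime b) (m_gt0 : (0 < m)%N) (s_gt0 : (0 < s)%N)
  (alpha_gt0 : (0 < alpha)%N) (d_gt0 : (0 < d)%N)
  (gamma : {set 'I_s} -> R) (gamma_ge0 : forall v, 0 <= gamma v)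
  (p : {poly 'F_b}) (deg_p : size p = m.+1)
  (q : 'I_(d * s) -> {poly 'F_b}) :
  let z := lattice_point R m q p in
  let D := Dconst R b alpha d in
  B_quality m alpha gamma q p =
    ((b ^ m)%N%:R^-1 *
     \sum_(n < b ^ m) \sum_(v : {set 'I_s} | v != finset.set0)
       gamma v * D ^+ #|v| *
       \prod_(j in v)
         (-1 + \prod_(k < d) (1 + phi b alpha d (z n (coord_idx j k)))))%:E
  /\
  (forall g : 'I_s -> R, (forall v, gamma v = \prod_(j in v) g j) ->
   B_quality m alpha gamma q p =
    (-1 + (b ^ m)%N%:R^-1 *
     \sum_(n < b ^ m) \prod_(j < s)
       (1 - g j * D +
        g j * D * \prod_(k < d) (1 + phi b alpha d (z n (coord_idx j k)))))%:E).
Proof.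
move=> z D.
have bm0 : (b ^ m)%N%:R != 0 :> R by rewrite pnatr_eq0 -lt0n expn_gt0 prime_gt0.
suff main : B_quality m alpha gamma q p =
    ((b ^ m)%N%:R^-1 *
     \sum_(n < b ^ m) \sum_(v : {set 'I_s} | v != finset.set0)
       gamma v * D ^+ #|v| *
       \prod_(j in v)
         (-1 + \prod_(k < d) (1 + phi b alpha d (z n (coord_idx j k)))))%:E.
  split=> // g gE; rewrite main; congr EFin.
  apply: (mulfI bm0); rewrite mulrDr !mulVKf// mulrN1.
  (* Writing [b ^ m] as a sum of ones distributes the [-1] over [n], so that the identity can be
     checked point by point. *)
  have -> : (b ^ m)%:R = \sum_(n < b ^ m) (1 : R) by rewrite sumr_const card_ord.
  rewrite -sumrN -big_split /=; apply: eq_bigr => n _.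
  have affineE (a x : R) : 1 - a + a * x = 1 + a * (-1 + x) by ring.
  under [in RHS]eq_bigr do rewrite affineE.
  (* In the expansion over all [v], the empty set contributes 1 and cancels the [-1]. *)
  rewrite prod_1D [in RHS](bigD1 finset.set0)//= big_set0 addKr.
  apply: eq_bigr => v _; rewrite gE !big_split /=.
  by rewrite prodr_const.
rewrite /B_quality.
(* Each inner sum is a finite real, so the rest is an identity in [R]. *)
under eq_bigr do rewrite (esum_dual_lattice _ b_prime alpha_gt0 d_gt0 _ deg_p) -EFinM.
rewrite sumEFin; congr EFin.
under eq_bigr do rewrite mulrCA mulr_sumr.
rewrite -mulr_sumr exchange_big; congr (_ * _); apply: eq_bigr => n _.
exact: (sum_over_vset (fun v => gamma v * D ^+ #|v|)).
Qed.
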